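(* There exists $k_0$ such that for all integers $k \ge k_0$, \[ r_k(\mathcal{L}) < 1.546\, k. \]
   Context: A 3-uniform hypergraph is a set of 3-element subsets (triples) of a vertex set. The loose path $\mathcal{L}$ is the 3-uniform hypergraph $\{abc, cde, efg\}$ on seven distinct vertices $a,b,c,d,e,f,g$. For a 3-uniform hypergraph $\mathcal{H}$, the multicolor Ramsey number $r_k(\mathcal{H})$ is the smallest integer $n$ such that every coloring of $\binom{[n]}{3}$ with $k$ colors contains a monochromatic copy of $\mathcal{H}$. *)

(* Defs.v *)
From HB Require Import structures.
From mathcomp Require Import all_boot all_order all_algebra.

Set Implicit Arguments.
Unset Strict Implicit.
Unset Printing Implicit Defensive.

(* A hypergraph on V is represented by its set of edges. *)
Definition hypergraph (V : finType) := {set {set V}}.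

Definition uniform3 (V : finType) (H : hypergraph V) : Prop :=
  forall e, e \in H -> #|e| = 3.

Definition triple (V : finType) : predArgType := {e : {set V} | #|e| == 3}.

Definition color_class (n k : nat) (chi : triple 'I_n -> 'I_k) (i : 'I_k) :
    hypergraph 'I_n :=
  [set val t | t : triple 'I_n & chi t == i].

(* G contains a (not necessarily induced) copy of H. *)
Definition contains_copy (V W : finType) (H : hypergraph V) (G : hypergraph W) :
    Prop :=
  exists2 f : V -> W, injective f & forall e, e \in H -> f @: e \in G.

Definition ramsey_property (V : finType) (H : hypergraph V) (k n : nat) : Prop :=
  forall chi : triple 'I_n -> 'I_k,
    exists i : 'I_k, contains_copy H (color_class chi i).

(* r = r_k(H).  The least n is specified by a relation, so that asserting
   [is_ramsey_number H k r] also asserts that r_k(H) exists. *)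
Definition is_ramsey_number (V : finType) (H : hypergraph V) (k r : nat) : Prop :=
  ramsey_property H k r /\ forall n, ramsey_property H k n -> r <= n.

Lemma is_ramsey_number_unique (V : finType) (H : hypergraph V) (k r s : nat) :
  is_ramsey_number H k r -> is_ramsey_number H k s -> r = s.
Proof.
by move=> [Hr minr] [Hs mins]; apply/eqP; rewrite eqn_leq minr // mins.
Qed.

(* The vertices a, ..., g are 0, ..., 6. *)
Definition loose_path : hypergraph 'I_7 :=
  [set [set inord 0; inord 1; inord 2];
       [set inord 2; inord 3; inord 4];
       [set inord 4; inord 5; inord 6]].

Lemma loose_path_uniform3 : uniform3 loose_path.
Proof.
move=> e; rewrite !inE -orbA.
by case/or3P => /eqP->; rewrite -setUA cardsU1 cards2 !inE -!val_eqE /= !inordK.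
Qed.

(* Main.v *)
From Stdlib Require Import Classical_Prop.
Require Import Defs.
From mathcomp Require Import all_boot all_order all_algebra.
From mathcomp Require Import zify ring lra.

(** In an L-free triple system, deleting O(n) triples leaves a system in which
    every triple contains either a vertex dominating its two other vertices or
    two vertices dominating each other, where z dominates v when all triples
    at v contain z; a vertex has at most one dominating vertex. For a
    k-colouring without monochromatic L, join x to y when y dominates x in no
    colour. All outdegrees of this digraph are at least n - 1 - k, it has O(n)
    2-cycles (a pair x, y with no domination lies in at most one remaining
    triple of each colour, while n - 2 - k is linear in n) and O(n^2) directed
    triangles. A random map from a bounded set of m points into the vertices
    therefore gives, with positive probability, a digraph without 2-cycles and
    triangles in which nearly all outdegrees are above 0.353 m. This contradicts
    a bound for the Caccetta-Haggkvist problem: every digraph on m points with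
    neither has a vertex of outdegree below 0.353 m, and
    1 / (1 - 0.353) < 1.546.

    For the latter we count transitive triangles as in Shen's proof for
    3 - sqrt 7, and improve the estimate inside the out-neighbourhoods with the
    Chudnovsky-Seymour-Sullivan theorem, by which such a digraph becomes
    acyclic after deleting at most as many arcs as it has nonadjacent pairs. *)

Import Order.TTheory GRing.Theory Num.Theory.

Set Implicit Arguments.
Unset Strict Implicit.
Unset Printing Implicit Defensive.

(** * Digraphs without directed 2-cycles and triangles *)

Definition arcs (V : finType) (e : rel V) (P Q : {set V}) : nat :=
  \sum_(x in P) \sum_(y in Q) e x y.

Definition gap (V : finType) (e : rel V) : rel V :=
  fun x y => [&& x != y, ~~ e x y & ~~ e y x].

Definition no_short_cycle (V : finType) (e : rel V) : Prop :=
  (forall x y, e x y -> e y x -> False) /\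
  (forall x y z, e x y -> e y z -> e z x -> False).

Definition outs_in (V : finType) (e : rel V) (H : {set V}) (x : V) : {set V} :=
  [set y in H | e x y].

Section Arcs.
Variables (V : finType) (e : rel V).
Implicit Types (P Q H J : {set V}).

Lemma arcs_out P Q : arcs e P Q = \sum_(x in P) #|outs_in e Q x|.
Proof.
apply: eq_bigr => x _; rewrite -sum1_card big_mkcond [in RHS]big_mkcond /=.
by apply: eq_bigr => y _; rewrite inE; case: (y \in Q); case: (e x y).
Qed.

Lemma arcsUl P1 P2 Q :
  [disjoint P1 & P2] -> arcs e (P1 :|: P2) Q = arcs e P1 Q + arcs e P2 Q.
Proof. by move=> dis; rewrite /arcs -bigU //; apply: eq_bigl => x; rewrite !inE. Qed.

Lemma arcsUr P Q1 Q2 :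
  [disjoint Q1 & Q2] -> arcs e P (Q1 :|: Q2) = arcs e P Q1 + arcs e P Q2.
Proof.
move=> dis; rewrite /arcs -big_split; apply: eq_bigr => x _ /=.
by rewrite -bigU //; apply: eq_bigl => y; rewrite !inE.
Qed.

Lemma arcs_subl P1 P2 Q : P1 \subset P2 -> arcs e P1 Q <= arcs e P2 Q.
Proof.
move=> s12; rewrite /arcs [X in _ <= X](big_setID P1) /= (setIidPr s12).
exact: leq_addr.
Qed.

Lemma arcs_subr P Q1 Q2 : Q1 \subset Q2 -> arcs e P Q1 <= arcs e P Q2.
Proof.
move=> s12; apply: leq_sum => x _.
by rewrite [X in _ <= X](big_setID Q1) /= (setIidPr s12) leq_addr.
Qed.

Lemma arcs_max P Q : arcs e P Q <= #|P| * #|Q|.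
Proof.
rewrite arcs_out -sum_nat_const; apply: leq_sum => x _.
by apply: subset_leq_card; apply/subsetP => y; rewrite inE => /andP[].
Qed.

End Arcs.

Lemma gap_sym (V : finType) (e : rel V) : symmetric (gap e).
Proof. by move=> x y; rewrite /gap eq_sym [~~ e x y && _]andbC. Qed.

Lemma gaps_sym (V : finType) (e : rel V) (P Q : {set V}) :
  arcs (gap e) P Q = arcs (gap e) Q P.
Proof.
rewrite /arcs exchange_big; apply: eq_bigr => x _.
by apply: eq_bigr => y _; rewrite gap_sym.
Qed.

Lemma pronicD p q : (p + q) * (p + q).-1 = p * p.-1 + 2 * (q * p) + q * q.-1.
Proof.
case: p q => [|p] [|q]; rewrite ?(addn0, muln0, mul0n, add0n) //.
by rewrite addSn addnS /=; ring.
Qed.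

Section ShortCycleFree.
Variables (V : finType) (e : rel V).
Hypothesis nsc : no_short_cycle e.
Implicit Types (P Q H J : {set V}).

(* [arcs (gap e) H H] counts each nonadjacent pair twice. *)
Lemma arcs_gaps H : 2 * arcs e H H + arcs (gap e) H H + #|H| = #|H| * #|H|.
Proof.
have E : arcs e H H = \sum_(x in H) \sum_(y in H) e y x.
  by rewrite /arcs exchange_big.
rewrite mul2n -addnn {1}E /arcs -sum1_card -!big_split sum1_card -sum_nat_const.
apply: eq_bigr => x xH /=.
rewrite -!big_split /= [LHS](_ : _ = \sum_(y in H) (1 - (x == y)) + 1).
  rewrite (bigD1 x) //= eqxx add0n [in RHS](cardsD1 x) xH addnC; congr (_ + _).
  rewrite -sum1_card; apply: eq_big => y; first by rewrite !inE andbC.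
  by case/andP=> _ /negPf; rewrite eq_sym => ->.
congr (_ + _); apply: eq_bigr => y _; rewrite /gap.
have [<-|_] := eqVneq x y.
  by case exx: (e x x) => //; case: (nsc.1 x x).
by case exy: (e x y); case eyx: (e y x) => //; case: (nsc.1 x y).
Qed.

(* P is a vertex v with its out-neighbourhood. Then arcs from P to Q extend
   to induced paths v -> a -> b, and gaps between out- and in-neighbours of v are
   induced paths c -> v -> a; both counts have the same sum over v. *)
Lemma exists_sparse_cut H : 1 < #|H| ->
  exists P Q : {set V}, [/\ P :|: Q = H, [disjoint P & Q], 0 < #|P|, 0 < #|Q|
    & arcs e P Q <= arcs (gap e) P Q].
Proof.
move=> H2.
(* The cut at [v] needs a vertex of [H] outside [v] and its out-neighbours. If [v] sends arcs to all
   of [H :\ v], then [v] is split off instead, since no arc returns to it. *)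
have [v vH|noDom] := pickP [pred v in H | H :\ v \subset outs_in e H v].
  have {vH} [vH dom] := andP vH.
  exists (H :\ v), [set v]; rewrite setUC setD1K // cards1; split => //.
  - by rewrite disjoint_sym disjoints1 !inE eqxx.
  - by move: H2; rewrite (cardsD1 v) vH.
  - rewrite [arcs e _ _]big1 // => x xv; rewrite big_set1.
    case exv: (e x v) => //; move/subsetP: dom => /(_ _ xv).
    by rewrite inE => /andP[_ /nsc.1 /(_ exv)].
pose A v := outs_in e H v.
pose f v := \sum_(a in H) \sum_(b in H) [&& e v a, e a b & gap e v b].
pose g v := \sum_(a in H) \sum_(c in H) [&& e v a, e c v & gap e a c].
have Efg : \sum_(v in H) f v = \sum_(v in H) g v.
  rewrite /f /g.
  transitivity (\sum_(v in H) \sum_(c in H) \sum_(a in H)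
    ([&& e v a, e c v & gap e a c] : nat)).
    rewrite [RHS]exchange_big; apply: eq_bigr => c _; apply: eq_bigr => v _.
    by apply: eq_bigr => a _; rewrite gap_sym andbCA.
  by apply: eq_bigr => v _; rewrite exchange_big.
have [v vH fg] : exists2 v, v \in H & f v <= g v.
  apply/exists_inP; apply: contraTT H2 => /exists_inPn fgt.
  rewrite -leqNgt; have [->|/set0Pn[v vH]] := eqVneq H set0; first by rewrite cards0.
  suff : \sum_(v in H) g v < \sum_(v in H) f v by rewrite Efg ltnn.
  rewrite (bigD1 v) //= [X in _ < X](bigD1 v) //= -addSn.
  apply: leq_add; first by rewrite ltnNge fgt.
  by apply: leq_sum => w /andP[wH _]; rewrite ltnW // ltnNge fgt.
pose P := v |: A v; pose Q := H :\: P.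
have PH : P \subset H.
  by apply/subsetP => x; rewrite !inE => /predU1P[->|/andP[]].
exists P, Q; split.
- by rewrite /Q -[in RHS](setID H P) (setIidPr PH).
- by rewrite -setI_eq0 /Q setIDA setDIl setDv set0I.
- by apply/card_gt0P; exists v; rewrite !inE eqxx.
- have := noDom v; rewrite inE vH /= => /negbT /subsetPn[x].
  rewrite !inE => /andP[xv xH] nx; apply/card_gt0P; exists x.
  by rewrite !inE (negPf xv) xH /= andbT; move: nx; rewrite xH.
have irr x : e x x = false by apply/negP => ev; exact: (nsc.1 _ _ ev ev).
(* An arc from [P] into [b] in [Q] cannot start at [v], so it starts at some [a] in [A v]; an arc
   from [b] to [v] would close a triangle, so [v], [b] is a gap. *)
apply: leq_trans (leq_trans fg _).
  rewrite /f /arcs big_mkcond /= [X in _ <= X]big_mkcond /=.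
  apply: leq_sum => a _.
  case aP: (a \in P) => //.
  rewrite (subsetP PH) //.
  rewrite big_mkcond /= [X in _ <= X]big_mkcond /=; apply: leq_sum => b _.
  case bQ: (b \in Q) => //; move: bQ; rewrite !inE negb_or => /andP[/andP[bv nvb] bH].
  rewrite bH; case eab: (e a b) => //.
  rewrite bH /= in nvb.
  move: aP; rewrite !inE => /predU1P[av|/andP[_ eva]].
    by move: nvb; rewrite -av eab.
  rewrite eva /gap eq_sym bv nvb /=.
  by case ebv: (e b v) => //; case: (nsc.2 v a b).
rewrite /g /arcs big_mkcond /= [X in _ <= X]big_mkcond /=.
apply: leq_sum => a _; case aH: (a \in H) => //.
case eva: (e v a); last by rewrite big1 //; case: ifP.
rewrite !inE aH eva orbT.
rewrite big_mkcond /= [X in _ <= X]big_mkcond /=; apply: leq_sum => c _.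
case cH: (c \in H) => //; case ecv: (e c v) => //=.
rewrite !inE cH.
case: eqVneq => [cv|_]; first by rewrite cv irr in ecv.
by case evc: (e v c) => //; case: (nsc.1 v c).
Qed.

(* J consists of the last j vertices of the ordering obtained by iterating the
   cuts: its out-arcs are backward arcs or arcs inside J. *)
Lemma exists_low_out_sum H j : j <= #|H| ->
  exists J : {set V}, [/\ J \subset H, #|J| = j
    & 2 * arcs e J H <= j * j.-1 + arcs (gap e) H H].
Proof.
have [n] := ubnP #|H|; elim: n H j => // n IHn H j Hn jH.
have [H2|H1] := ltnP 1 #|H|; last first.
  have := arcs_gaps H.
  case: j jH => [|j] jH.
    exists set0; rewrite sub0set cards0; split => //.
    by rewrite /arcs big_set0.
  by rewrite (_ : #|H| = 1) => [ag|]; [exists H; split => //; lia | lia].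
have [P [Q [HPQ dis P0 Q0 cut]]] := exists_sparse_cut H2.
have cH : #|H| = #|P| + #|Q|.
  by rewrite -HPQ cardsU (disjoint_setI0 dis) cards0 subn0.
have gH : arcs (gap e) H H =
    arcs (gap e) P P + arcs (gap e) Q Q + 2 * arcs (gap e) P Q.
  rewrite -HPQ arcsUl // !arcsUr // (gaps_sym e Q P); lia.
(* [P] comes last in the ordering. If [j] fits, [J] is chosen inside [P] and its arcs to [Q] are
   paid for by the gaps of the cut; otherwise [J] takes all of [P] and the remainder from [Q]. *)
have [jP|Pj] := leqP j #|P|.
  have [||J [JP cJ sJ]] := IHn P j; [lia | by []|].
  exists J; split => //; first by rewrite -HPQ subsetU // JP.
  have := arcs_subl e Q JP.
  rewrite gH -HPQ arcsUr //; lia.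
have [||J [JQ cJ sJ]] := IHn Q (j - #|P|); [lia|lia|].
have dJ : [disjoint P & J] by rewrite disjoint_sym (disjointWl JQ) // disjoint_sym.
exists (P :|: J); split.
- by rewrite -HPQ setUS.
- by rewrite cardsU (disjoint_setI0 dJ) cards0 cJ; lia.
rewrite gH -HPQ arcsUl // !arcsUr //.
have := arcs_gaps P; have := arcs_max e J P; rewrite cJ.
have := pronicD #|P| (j - #|P|); rewrite subnKC ?(ltnW Pj) // => ->.
have : #|P| * #|P| = #|P| * #|P|.-1 + #|P| by case: #|P| => //= ?; lia.
lia.
Qed.

(** Let d be the minimum outdegree. A set of d vertices sends out at least d^2 arcs, so the previous
    bound with [j] = d gives 2 d^2 <= d (d - 1) + gaps. *)
Lemma exists_low_out H : 0 < #|H| ->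
  exists2 w, w \in H & #|outs_in e H w| ^ 2 <= arcs (gap e) H H.
Proof.
case/card_gt0P=> x0 x0H.
case: (arg_minnP (fun w => #|outs_in e H w|) x0H) => w wH wmin.
exists w => //; have dH : #|outs_in e H w| <= #|H|.
  by apply: subset_leq_card; apply/subsetP => y; rewrite inE => /andP[].
have [J [JH cJ sJ]] := exists_low_out_sum dH.
suff : #|J| * #|outs_in e H w| <= arcs e J H by rewrite cJ in sJ *; nia.
rewrite arcs_out -sum_nat_const; apply: leq_sum => x xJ.
exact/wmin/(subsetP JH).
Qed.

End ShortCycleFree.

(** * Outdegrees in triangle-free digraphs *)

Definition outs (V : finType) (e : rel V) (x : V) : {set V} := [set y | e x y].
Definition ins (V : finType) (e : rel V) (x : V) : {set V} := [set y | e y x].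

Lemma cardU_disj (V : finType) (A B : {set V}) :
  [disjoint A & B] -> #|A :|: B| = #|A| + #|B|.
Proof. by move=> dis; rewrite cardsU (disjoint_setI0 dis) cards0 subn0. Qed.

Lemma exists_subset_card (V : finType) (A : {set V}) r :
  r <= #|A| -> #|[set x in take r (enum A)]| = r.
Proof.
move=> rA; rewrite cardsE (card_uniqP _) ?take_uniq ?enum_uniq //.
by rewrite size_take -cardE; case: ltngtP rA.
Qed.

(** For [j] = 2h/3 the bounds are 0.353 (4/9 + 16/289) / 2 < 0.0883 for [s1] and 4/51 < 0.0785 for
    [s2], in units of h^2. The rounding of [j] is absorbed by x^2 <= 2x for x = 3j - 2h in {0, 1,
    2}. *)
Lemma loss_arith h j G A s1 s2 :
  289 * G < 16 * h ^ 2 -> 2 * A <= j * j.-1 + G ->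
  17 * s2 <= 4 * h * (h - j) -> 2 * h <= 3 * j -> 3 * j <= 2 * h + 2 ->
  j <= h -> 1000 * s1 <= 353 * A -> 1000 * (s1 + s2) <= 167 * h ^ 2.
Proof.
rewrite -!mulnn => a1 a2 a3 a4 a5 a6 a7.
have {}a2 : 2 * A + j <= j * j + G by case: j a2 {a3 a4 a5 a6} => //= j; lia.
have {}a3 : 17 * s2 + 4 * (h * j) <= 4 * (h * h).
  by move: a3; rewrite mulnBr -!mulnA; have := leq_mul (leqnn h) a6; lia.
have a8 : 9 * (j * j) + 4 * (h * h) + 4 * h <= 12 * (h * j) + 6 * j.
  have : (3 * j - 2 * h) * (3 * j - 2 * h) <= 2 * (3 * j - 2 * h).
    by rewrite leq_mul2r; apply/orP; right; lia.
  nia.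
lia.
Qed.

(* For arcs u -> v, [l v] bounds the minimum outdegree in the common
   out-neighbourhood of u and v, and H is the out-neighbourhood of u. If the gaps
   are at least (4/17)^2 |H|^2, then the transitive triangles are few; otherwise
   l <= 4/17 |H|, which is better than l v <= 0.353 d(v) outside the low 2/3 of
   the vertices (2/3 is close to (4/17) / 0.353). *)
Lemma loss_sum_le (V : finType) (e : rel V) (H : {set V}) (l : V -> nat) :
  no_short_cycle e ->
  (forall v, v \in H -> 1000 * l v <= 353 * #|outs_in e H v|) ->
  (forall v, v \in H -> l v ^ 2 <= arcs (gap e) H H) ->
  1000 * \sum_(v in H) l v <= 167 * #|H| ^ 2.
Proof.
move=> nsc l1 l2; have ag := arcs_gaps nsc H.
have lJ (J : {set V}) : J \subset H -> 1000 * \sum_(v in J) l v <= 353 * arcs e J H.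
  move=> JH; rewrite arcs_out !big_distrr /=; apply: leq_sum => v vJ.
  exact/l1/(subsetP JH).
(* The first case gives 0.353 (1 - 16/289) / 2 < 0.16673; the second gives nearly the same, so 4/17
   balances the two. *)
have [big_gap|small_gap] := leqP (16 * #|H| ^ 2) (289 * arcs (gap e) H H).
  have := lJ H (subxx _); rewrite -mulnn in big_gap *; lia.
have l3 v : v \in H -> 17 * l v <= 4 * #|H|.
  by move/l2; rewrite -!mulnn in small_gap *; nia.
pose j := (2 * #|H| + 2) %/ 3.
have [j1 j2] : 2 * #|H| <= 3 * j /\ 3 * j <= 2 * #|H| + 2 by rewrite /j; lia.
have jH : j <= #|H| by lia.
have [J [JH cJ sJ]] := exists_low_out_sum nsc jH.
rewrite (big_setID J) /= (setIidPr JH).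
have rest : 17 * \sum_(v in H :\: J) l v <= 4 * #|H| * (#|H| - j).
  have <- : #|H :\: J| = #|H| - j by rewrite cardsD (setIidPr JH) cJ.
  rewrite [X in _ <= X]mulnC -sum_nat_const big_distrr /=.
  by apply: leq_sum => v /setDP[/l3].
exact: loss_arith small_gap sJ rest j1 j2 jH (lJ J JH).
Qed.

(** The transitive triangles [t] cancel, leaving 3 s r^2 <= s^2 r + 0.167 s r^2, which is divided by
    s r. *)
Lemma regular_arith s r Q L t :
  1000 * L <= 167 * (s * r ^ 2) -> r * (s * r) <= Q ->
  s * (r * r) + Q + r * (s * r) + t <= s * (r * s) + t + L ->
  0 < s -> 0 < r -> 2833 * r <= 1000 * s.
Proof.
rewrite -mulnn => h1 h2 h3 s0 r0.
have : (2833 * r) * (s * r) <= (1000 * s) * (s * r) by lia.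
by rewrite leq_pmul2r // muln_gt0 s0.
Qed.

Section Regular.
Variables (V : finType) (e : rel V) (S : {set V}) (r : nat).
Hypothesis nsc : no_short_cycle e.
Hypothesis eS : forall x y, e x y -> (x \in S) && (y \in S).
Hypothesis reg : forall x, x \in S -> #|outs e x| = r.
Hypothesis IH : forall T : {set V}, 0 < #|T| < #|S| ->
  exists2 v, v \in T & 1000 * #|outs_in e T v| < 353 * #|T|.

(* w is a vertex of minimum outdegree l in the common out-neighbourhood of u
   and v. The out-neighbours of v, the in-neighbours of u or v, and the
   out-neighbours of w that are not out-neighbours of v are disjoint. *)
Lemma arc_loss u v : e u v -> exists l : nat,
  [/\ 1000 * l <= 353 * #|outs_in e (outs e u) v|,
      l ^ 2 <= arcs (gap e) (outs e u) (outs e u) &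
      r + #|ins e v| + #|ins e u| + #|outs e u :&: outs e v|
        <= #|S| + #|ins e u :&: ins e v| + l].
Proof.
move=> euv; have /andP[uS vS] := eS euv.
have -> : outs_in e (outs e u) v = outs e u :&: outs e v.
  by apply/setP=> x; rewrite !inE.
set T := outs e u :&: outs e v.
suff [l [Z [l1 l2 TZ dZ]]] : exists l : nat, exists Z : {set V},
    [/\ 1000 * l <= 353 * #|T|, l ^ 2 <= arcs (gap e) (outs e u) (outs e u),
      #|T| <= #|Z| + l
      & Z \subset S :\: (outs e v :|: (ins e u :|: ins e v))].
  exists l; split => //.
  have cU := cardsUI (ins e u) (ins e v).
  have dO : [disjoint outs e v & ins e u :|: ins e v].
    rewrite -setI_eq0; apply/eqP/setP => x; rewrite !inE; apply/negP.
    move=> /andP[evx /orP[exu|exv]]; first exact: nsc.2 _ _ _ euv evx exu.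
    exact: nsc.1 evx exv.
  have cO := cardU_disj dO; rewrite (reg vS) in cO.
  have UO : outs e v :|: (ins e u :|: ins e v) \subset S.
    by apply/subsetP=> x; rewrite !inE => /or3P[] /eS /andP[].
  have := subset_leq_card dZ; rewrite cardsD (setIidPr UO).
  have := subset_leq_card UO; lia.
have [T0|] := posnP #|T|; first by exists 0, set0; rewrite T0 cards0 sub0set.
move=> /[dup] Tpos /card_gt0P [x0 x0T].
case: (arg_minnP (fun w => #|outs_in e T w|) x0T) => w wT wmin.
have /setIP[] := wT; rewrite !inE => euw evw; have /andP[_ wS] := eS evw.
exists #|outs_in e T w|, (outs e w :\: outs e v); split.
- have TS : #|T| < #|S|.
    apply: proper_card; apply/properP; split.
      by apply/subsetP=> x; rewrite !inE => /andP[/eS /andP[]].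
    by exists u => //; rewrite !inE; apply/andP => -[/[dup] /nsc.1 h /h].
  have [|x xT xlt] := IH (T := T); first by rewrite Tpos.
  exact/ltnW/(leq_ltn_trans (leq_mul (leqnn _) (wmin x xT)) xlt).
- have [x xT xle] := exists_low_out nsc Tpos.
  have TO : T \subset outs e u by apply: subsetIl.
  apply: leq_trans (leq_trans (arcs_subl _ _ TO) (arcs_subr _ _ TO)).
  by apply: leq_trans xle; rewrite leq_sqr wmin.
(* The out-neighbours of [w] inside those of [v] lie in [T], where [w] has l of them, or outside
   [outs e u], where there is room for r - |T|. So at least |T| - l others remain. *)
- have c1 : #|T| + #|outs e v :\: outs e u| = r by rewrite /T setIC cardsID reg.
  have c2 : #|outs e w :&: outs e v| + #|outs e w :\: outs e v| = r.
    by rewrite cardsID reg.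
  have c3 : #|outs e w :&: outs e v| <= #|outs_in e T w| + #|outs e v :\: outs e u|.
    rewrite -(cardsID (outs e u) (outs e w :&: outs e v)) leq_add //.
      apply: subset_leq_card; apply/subsetP=> x; rewrite !inE.
      by case: (e w x); case: (e u x); case: (e v x).
    apply: subset_leq_card; apply/subsetP=> x; rewrite !inE.
    by case: (e w x); case: (e u x); case: (e v x).
  by move: c1 c2 c3; clear; move: #|T| #|outs_in _ _ _|; lia.
- apply/subsetP=> x; rewrite !inE => /andP[nvx ewx].
  have /andP[_ ->] := eS ewx; rewrite andbT (negPf nvx) /=.
  by apply/norP; split; apply/negP => h;
    [exact: nsc.2 euw ewx h|exact: nsc.2 evw ewx h].
Qed.

(* 2833 = 3000 - 167, and 2833 * 353 > 1000 ^ 2. *)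
Lemma regular_bound : 0 < #|S| -> 0 < r -> 2833 * r <= 1000 * #|S|.
Proof.
move=> S0 r0.
pose l u v := r + #|ins e v| + #|ins e u| + #|outs e u :&: outs e v|
  - (#|S| + #|ins e u :&: ins e v|).
have lbound u : 1000 * \sum_(v in outs e u) l u v <= 167 * #|outs e u| ^ 2.
  apply: (loss_sum_le nsc) => v; rewrite inE => /arc_loss[k [k1 k2 k3]].
    by apply: leq_trans k1; rewrite /l; lia.
  by apply: leq_trans k2; rewrite leq_sqr /l; lia.
have Out0 u : u \notin S -> outs e u = set0.
  move=> uS; apply/setP=> y; rewrite !inE; apply/negP => /eS /andP[uS' _].
  by rewrite uS' in uS.
have sumOut (F : V -> V -> nat) :
    \sum_(u in S) \sum_(v in outs e u) F u v = \sum_u \sum_v e u v * F u v.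
  rewrite big_mkcond; apply: eq_bigr => u _; case: ifPn => [_|uS].
    rewrite big_mkcond; apply: eq_bigr => v _; rewrite inE.
    by case: (e u v); rewrite ?mul1n ?mul0n.
  rewrite big1 // => v _; case euv: (e u v) => //.
  by case/eS/andP: euv uS => ->.
have cOut u : #|outs e u| = \sum_v e u v.
  by rewrite -sum1_card big_mkcond; apply: eq_bigr => v _; rewrite inE; case: (e u v).
have cIn v : #|ins e v| = \sum_u e u v.
  by rewrite -sum1_card big_mkcond; apply: eq_bigr => u _; rewrite inE; case: (e u v).
have sum_l : 1000 * (\sum_(u in S) \sum_(v in outs e u) l u v) <= 167 * (#|S| * r ^ 2).
  rewrite mulnCA -sum_nat_const !big_distrr /=; apply: leq_sum => u uS.
  by rewrite -(reg uS) mulnC; have := lbound u; lia.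
have sum_c c : \sum_(u in S) \sum_(v in outs e u) c = #|S| * (r * c).
  rewrite -sum_nat_const; apply: eq_bigr => u uS.
  by rewrite sum_nat_const reg.
have sum_in : \sum_v #|ins e v| = #|S| * r.
  rewrite (eq_bigr _ (fun v _ => cIn v)) exchange_big /=.
  rewrite -[RHS]sum_nat_const [RHS]big_mkcond; apply: eq_bigr => u _ /=.
  by rewrite -cOut; case: ifPn => [/reg|/Out0 ->] //; rewrite cards0.
have sum_inu : \sum_(u in S) \sum_(v in outs e u) #|ins e u| = r * (#|S| * r).
  rewrite -sum_in big_distrr big_mkcond; apply: eq_bigr => u _ /=.
  case: ifPn => [uS|uS]; first by rewrite sum_nat_const reg.
  rewrite [#|ins e u|](_ : _ = 0) ?muln0 // cIn big1 // => x _.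
  by apply/eqP; rewrite eqb0; apply: contra uS => /eS /andP[].
have sum_inv :
    \sum_(u in S) \sum_(v in outs e u) #|ins e v| = \sum_v #|ins e v| ^ 2.
  rewrite sumOut exchange_big; apply: eq_bigr => v _ /=.
  by rewrite -big_distrl /= -cIn mulnn.
(* Cauchy-Schwarz for the indegrees, whose mean over [S] is [r]. *)
have sum_sq : r * (#|S| * r) <= \sum_v #|ins e v| ^ 2.
  have : \sum_(v in S) (2 * r * #|ins e v|) <= \sum_(v in S) (#|ins e v| ^ 2 + r ^ 2).
    by apply: leq_sum => v _; rewrite mulnAC -mulnA nat_Cauchy.
  rewrite -big_distrr big_split /= sum_nat_const.
  have sub (F : nat -> nat) : F 0 = 0 ->
      \sum_(v in S) F #|ins e v| = \sum_v F #|ins e v|.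
    move=> F0; rewrite big_mkcond; apply: eq_bigr => v _; case: ifPn => // vS.
    rewrite [#|ins e v|](_ : _ = 0) ?F0 // cIn big1 // => x _.
    by apply/eqP; rewrite eqb0; apply: contra vS => /eS /andP[].
  rewrite (sub id) // (sub (fun x => x ^ 2)) // sum_in -mulnn; nia.
(* Both sides count transitive triangles: on the left by the arc from source to middle vertex, on
   the right by the arc from middle vertex to sink. *)
have sum_t : \sum_(u in S) \sum_(v in outs e u) #|outs e u :&: outs e v| =
    \sum_(u in S) \sum_(v in outs e u) #|ins e u :&: ins e v|.
  have cI (P Q : pred V) : #|[set x | P x] :&: [set x | Q x]| = \sum_x P x && Q x.
    rewrite -sum1_card big_mkcond; apply: eq_bigr => x _.
    by rewrite !inE; case: (P x && Q x).
  rewrite !sumOut; under eq_bigr => u _ do under eq_bigr => v _ do rewrite cI big_distrr.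
  under [RHS]eq_bigr => u _ do under eq_bigr => v _ do rewrite cI big_distrr.
  rewrite /=.
  rewrite [RHS](eq_bigr (fun u => \sum_x \sum_v e u v * (e x u && e x v))); last first.
    by move=> u _; rewrite exchange_big.
  rewrite [RHS]exchange_big; apply: eq_bigr => u _; apply: eq_bigr => v _.
  by apply: eq_bigr => x _; case: (e u v); case: (e v x); case: (e u x).
have : \sum_(u in S) \sum_(v in outs e u)
    (r + #|ins e v| + #|ins e u| + #|outs e u :&: outs e v|)
    <= \sum_(u in S) \sum_(v in outs e u) (#|S| + #|ins e u :&: ins e v| + l u v).
  by apply: leq_sum => u _; apply: leq_sum => v _; rewrite /l; lia.
have split2 (F G : V -> V -> nat) : \sum_(u in S) \sum_(v in outs e u) (F u v + G u v)
    = \sum_(u in S) \sum_(v in outs e u) F u v + \sum_(u in S) \sum_(v in outs e u) G u v.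
  by rewrite -big_split; apply: eq_bigr => u _; rewrite big_split.
rewrite !split2 !sum_c sum_t sum_inu sum_inv.
move=> sum_all; exact: regular_arith sum_l sum_sq sum_all S0 r0.
Qed.

End Regular.

(** In a smallest counterexample, every out-neighbourhood is thinned to the minimum outdegree r >=
    0.353 |S|. This creates no short cycle, and [regular_bound] then fails because 2833 * 353 =
    1000049. *)
Theorem exists_small_outdegree (V : finType) (e : rel V) (S : {set V}) :
  no_short_cycle e -> 0 < #|S| ->
  exists2 v, v \in S & 1000 * #|outs_in e S v| < 353 * #|S|.
Proof.
have [n] := ubnP #|S|; elim: n e S => // n IHn e S Sn nsc S0.
apply/exists_inP; apply: contraT => /exists_inPn big.
have [x0 x0S] := card_gt0P S0.
case: (arg_minnP (fun w => #|outs_in e S w|) x0S) => w wS wmin.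
pose r := #|outs_in e S w|.
pose e' x y := (x \in S) && (y \in take r (enum (outs_in e S x))).
have e'P x y : e' x y -> [/\ x \in S, y \in S & e x y].
  by case/andP=> xS /mem_take; rewrite mem_enum inE => /andP[].
have nsc' : no_short_cycle e'.
  split=> [x y /e'P[_ _ xy] /e'P[_ _]|x y z /e'P[_ _ xy] /e'P[_ _ yz] /e'P[_ _]].
    exact: nsc.1.
  exact: nsc.2 yz.
have r_big : 353 * #|S| <= 1000 * r by have := big w wS; rewrite -leqNgt.
have : 2833 * r <= 1000 * #|S|.
  apply: (regular_bound (e := e')) => //; last by lia.
  - by move=> x y /e'P[-> ->].
  - move=> x xS; rewrite -[RHS](exists_subset_card (wmin x xS)).
    by apply: eq_card => y; rewrite !inE /e' xS.
  - by move=> T /andP[T0 TS]; apply: IHn => //; lia.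
lia.
Qed.

(** * Sampling *)

Local Open Scope ring_scope.


Lemma sum_const_card (I : finType) (c : rat) : \sum_(i : I) c = #|I|%:R * c.
Proof. by rewrite sumr_const mulr_natl. Qed.

Lemma sum_eq0 (I : finType) (F : I -> nat) :
  (\sum_i F i)%N = 0%N -> forall i, F i = 0%N.
Proof. by move=> /eqP; rewrite sum_nat_eq0 => /forallP h i; exact/eqP/(h i). Qed.

Lemma ler_sum_card (I : finType) (F : I -> rat) (b : rat) :
  (forall i, F i <= b) -> \sum_i F i <= #|I|%:R * b.
Proof. by move=> Fb; rewrite -sum_const_card; apply: ler_sum => i _. Qed.

Section Resampling.
Variables (I T : finType).
Implicit Types (f : {ffun I -> T}) (i j l : I).

Definition update f l (y : T) : {ffun I -> T} :=
  [ffun i => if i == l then y else f i].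

Lemma update_eq f l y : update f l y l = y.
Proof. by rewrite ffunE eqxx. Qed.

Lemma update_neq f l y i : i != l -> update f l y i = f i.
Proof. by rewrite ffunE => /negPf->. Qed.

(** Redrawing one coordinate preserves the uniform distribution: exchanging [y] with the old value
    at [l] is an involution on pairs. *)
Lemma sum_update (F : {ffun I -> T} -> rat) l :
  #|T|%:R * (\sum_f F f) = \sum_f \sum_y F (update f l y).
Proof.
rewrite [RHS]pair_big big_distrr /=.
under eq_bigr => f _ do rewrite mulr_natl -sumr_const.
rewrite pair_big /=.
pose h (p : {ffun I -> T} * T) := (update p.1 l p.2, p.1 l).
have hK : involutive h.
  case=> f y; rewrite /h /= update_eq; congr (_, _).
  by apply/ffunP=> i; rewrite !ffunE; case: eqP => [->|].
by rewrite [LHS](reindex_inj (inv_inj hK)).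
Qed.

Let N : rat := #|T|%:R.
Let F : rat := #|{ffun I -> T}|%:R.

Lemma sum_pair (c : T -> T -> rat) i j : i != j ->
  N * (N * \sum_(f : {ffun I -> T}) c (f i) (f j)) = F * (\sum_x \sum_y c x y).
Proof.
move=> ij; rewrite (sum_update _ j).
under eq_bigr => f _ do under eq_bigr => y _ do rewrite update_eq update_neq //.
rewrite (sum_update _ i).
under eq_bigr => f _ do under eq_bigr => y _ do rewrite update_eq.
by rewrite sumr_const -mulr_natl.
Qed.

Lemma sum_triple (c : T -> T -> T -> rat) i j l : i != j -> i != l -> j != l ->
  N * (N * (N * \sum_(f : {ffun I -> T}) c (f i) (f j) (f l))) =
  F * (\sum_x \sum_y \sum_z c x y z).
Proof.
move=> ij il jl; rewrite (sum_update _ l).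
under eq_bigr => f _ do under eq_bigr => y _ do rewrite update_eq !update_neq //.
rewrite (sum_update _ j).
under eq_bigr => f _ do under eq_bigr => y _ do rewrite update_eq update_neq //.
rewrite (sum_update _ i).
under eq_bigr => f _ do under eq_bigr => y _ do rewrite update_eq.
by rewrite sumr_const -mulr_natl.
Qed.

(** Expand the square. For j <> j' one of the two differs from l, and redrawing that coordinate
    averages the product to 0; only the diagonal terms survive. *)
Lemma sum_sqr_deviation (g : T -> T -> rat) (b : rat) :
  (0 < #|T|)%N -> 0 <= b ->
  (forall x, \sum_y g x y = 0) -> (forall x y, `|g x y| <= b) ->
  \sum_(f : {ffun I -> T}) \sum_l (\sum_j g (f l) (f j)) ^+ 2
    <= F * (#|I|%:R ^+ 2 * b ^+ 2).
Proof.
move=> T0 b0 g0 gb; rewrite exchange_big /=.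
have cross l j j' : j != l -> j' != j ->
    \sum_(f : {ffun I -> T}) g (f l) (f j) * g (f l) (f j') = 0.
  move=> jl j'j; have /mulfI : N != 0 by rewrite pnatr_eq0 -lt0n.
  apply; rewrite mulr0 /N (sum_update _ j) big1 // => f _.
  under eq_bigr => y _ do
    rewrite update_eq (update_neq _ _ j'j) (update_neq _ _ (i := l)) 1?eq_sym //.
  by rewrite -big_distrl /= g0 mul0r.
have diag l j j' : \sum_(f : {ffun I -> T}) g (f l) (f j) * g (f l) (f j')
    <= if j == j' then F * b ^+ 2 else 0.
  have [->|jj'] := eqVneq j j'.
    rewrite mulr_natl -sumr_const; apply: ler_sum => f _.
    by rewrite -expr2 -real_normK ?num_real // lerXn2r ?nnegrE.
  have [jl|jl] := eqVneq j l; last by rewrite cross // eq_sym.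
  rewrite -jl in jj' *.
  under eq_bigr => f _ do rewrite mulrC.
  by rewrite cross // eq_sym.
have bound l : \sum_(f : {ffun I -> T}) (\sum_j g (f l) (f j)) ^+ 2
    <= F * (#|I|%:R * b ^+ 2).
  under eq_bigr => f _.
    rewrite expr2 big_distrl /=.
    under eq_bigr => j _ do rewrite big_distrr /=.
    over.
  rewrite exchange_big /=; under eq_bigr => j _ do rewrite exchange_big /=.
  rewrite mulrCA mulr_natl -sumr_const; apply: ler_sum => j _.
  rewrite (bigD1 j) //= -[leRHS]addr0 lerD //.
    by apply: le_trans (diag l j j) _; rewrite eqxx.
  apply: sumr_le0 => j' j'j; apply: le_trans (diag l j j') _.
  by rewrite eq_sym (negPf j'j).
apply: le_trans (ler_sum _ (fun l _ => bound l)) _.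
by rewrite sumr_const -[leLHS]mulr_natl expr2 -mulrA mulrCA.
Qed.

End Resampling.

Definition digons (V : finType) (e : rel V) : nat := \sum_x \sum_y (e x y && e y x).
Definition cyclic_triangles (V : finType) (e : rel V) : nat :=
  \sum_x \sum_y \sum_z [&& e x y, e y z & e z x].

(** * Second moment argument for a random sample of m vertices *)

Section Sampling.
Variables (V : finType) (e : rel V) (m r : nat).
Hypothesis irr : forall x, e x x = false.
Hypothesis reg : forall x, #|outs e x| = r.
Hypothesis V0 : (0 < #|V|)%N.
(** The centred arc indicator, scaled by [#|V|]; positive sums over a sample mean fewer
    out-neighbours than expected. *)
Let g (x y : V) : rat := r%:R - #|V|%:R * (e x y)%:R.

Lemma g_bound x y : `|g x y| <= #|V|%:R.
Proof.
have rV : (r <= #|V|)%N by rewrite -(reg x) max_card.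
have : (r%:R : rat) <= #|V|%:R by rewrite ler_nat.
have : 0 <= (r%:R : rat) by rewrite ler0n.
rewrite /g ler_norml; move: (r%:R : rat) (#|V|%:R : rat) => a b a0 ab.
case: (e x y); rewrite ?mulr1 ?mulr0 ?subr0; lra.
Qed.

Lemma g_sum x : \sum_y g x y = 0.
Proof.
rewrite big_split /= sum_const_card sumrN -big_distrr /= -natr_sum.
rewrite [X in _ - _ * X%:R](_ : _ = r) ?subrr // -(reg x) -sum1_card [RHS]big_mkcond.
by apply: eq_bigr => y _; rewrite inE; case: (e x y).
Qed.

Variables c rho eta : rat.
Hypothesis c0 : 0 <= c.
Hypothesis eta0 : 0 < eta.
Hypothesis eta1 : eta <= 1.
Hypothesis rho_ge : c + eta + eta <= rho.
Hypothesis r_big : rho * #|V|%:R <= r%:R.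
Hypothesis small_outdegree : forall (d : rel 'I_m) (S : {set 'I_m}),
  no_short_cycle d -> (0 < #|S|)%N ->
  exists2 v, v \in S & (#|outs_in d S v|%:R : rat) < c * #|S|%:R.

Let sample_cycles (f : {ffun 'I_m -> V}) : nat :=
  digons (fun i j => e (f i) (f j)) + cyclic_triangles (fun i j => e (f i) (f j)).

(* The vertices of small outdegree are numerous: a digraph induced on the others
   would have one more of them. *)
Lemma acyclic_sample_deviation (f : {ffun 'I_m -> V}) : sample_cycles f = 0%N ->
  eta ^+ 3 * (#|V|%:R ^+ 2 * m%:R ^+ 3)
    <= \sum_l (\sum_j g (f l) (f j)) ^+ 2.
Proof.
move=> /eqP; rewrite addn_eq0 => /andP[/eqP d0 /eqP t0].
pose ef i j := e (f i) (f j).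
have nsc : no_short_cycle ef.
  split=> [i j ij ji|i j l ij jl li].
    have := sum_eq0 (sum_eq0 d0 i) j; rewrite -/(ef i j) -/(ef j i).
    by rewrite ij ji.
  have := sum_eq0 (sum_eq0 (sum_eq0 t0 i) j) l.
  by rewrite -/(ef i j) -/(ef j l) -/(ef l i) ij jl li.
pose low := [set l | (#|outs ef l|%:R : rat) < (c + eta) * m%:R].
have low_big : eta * m%:R <= #|low|%:R.
  have [S0|/set0Pn[l0 l0S]] := eqVneq (~: low) set0.
    have -> : low = setT by rewrite -[low]setCK S0 setC0.
    by rewrite cardsT card_ord ler_piMl ?ler0n.
  have [|l lS ll] := small_outdegree nsc (S := ~: low).
    by apply/card_gt0P; exists l0.
  move: lS; rewrite !inE -leNgt => lS.
  have c1 : (#|outs ef l| <= #|outs_in ef (~: low) l| + #|low|)%N.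
    rewrite -(cardsID low (outs ef l)) addnC leq_add //.
      by apply: subset_leq_card; apply/subsetP=> x; rewrite !inE.
    exact/subset_leq_card/subsetIr.
  have c2 : (#|~: low| <= m)%N by rewrite -[X in (_ <= X)%N]card_ord max_card.
  move: c1 c2; rewrite -!(ler_nat rat) natrD => c1 c2.
  have c3 := ler_wpM2l c0 c2.
  move: ll lS c1 c3.
  move: #|outs ef l|%:R #|low|%:R m%:R #|~: low|%:R #|outs_in _ _ _|%:R => o v k s t.
  lra.
have dev l : l \in low -> eta * (#|V|%:R * m%:R) <= \sum_j g (f l) (f j).
  rewrite inE => ll; rewrite big_split /= sum_const_card card_ord sumrN.
  rewrite -big_distrr /= -natr_sum.
  have -> : (\sum_j e (f l) (f j))%N = #|outs ef l|.
    rewrite -sum1_card [RHS]big_mkcond; apply: eq_bigr => j _; rewrite inE.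
    by rewrite /ef; case: (e _ _).
  have h1 : (#|V|%:R : rat) * #|outs ef l|%:R <= #|V|%:R * ((c + eta) * m%:R).
    by rewrite ler_wpM2l ?ler0n // ltW.
  have h2 : m%:R * ((c + eta + eta) * #|V|%:R) <= m%:R * r%:R :> rat.
    rewrite ler_wpM2l ?ler0n //; apply: le_trans r_big.
    by rewrite ler_wpM2r ?ler0n.
  apply: le_trans (lerB h2 h1).
  by rewrite le_eqVlt; apply/orP; left; apply/eqP; ring.
have -> : eta ^+ 3 * (#|V|%:R ^+ 2 * m%:R ^+ 3)
    = eta * m%:R * (eta * (#|V|%:R * m%:R)) ^+ 2 by ring.
apply: (@le_trans _ _ (\sum_(l in low) (eta * (#|V|%:R * m%:R)) ^+ 2)).
  by rewrite sumr_const -[leRHS]mulr_natl ler_wpM2r ?sqr_ge0.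
rewrite [leRHS](bigID (mem low)) /= -[leLHS]addr0 lerD //; last first.
  by apply: sumr_ge0 => l _; rewrite sqr_ge0.
apply: ler_sum => l /dev ld; rewrite lerXn2r ?nnegrE //.
  by rewrite !mulr_ge0 ?ler0n ?ltW.
by apply: le_trans ld; rewrite !mulr_ge0 ?ler0n ?ltW.
Qed.

Hypothesis m_big : 2 < eta ^+ 3 * m%:R.

(** A sample without short cycles has squared deviation at least [K], while the mean is at most K/2
    by [m_big]. Hence the expected number of short cycles in a sample is at least 1/2, and that
    number is bounded by the counts in [e]. *)
Lemma many_short_cycles :
  (#|V| ^ 3 <= 2 * (m ^ 2 * (digons e * #|V|) + m ^ 3 * cyclic_triangles e))%N.
Proof.
have m0 : (0 : rat) < m%:R.
  rewrite ltr0n lt0n; apply/eqP => m0.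
  by move: m_big; rewrite m0 mulr0; lra.
have N0 : (0 : rat) < #|V|%:R by rewrite ltr0n.
pose F : rat := #|{ffun 'I_m -> V}|%:R.
have F0 : 0 < F by rewrite ltr0n card_ffun expn_gt0 V0.
pose K := eta ^+ 3 * (#|V|%:R ^+ 2 * m%:R ^+ 3).
have K0 : 0 < K by rewrite !mulr_gt0 ?exprn_gt0.
have each (f : {ffun 'I_m -> V}) : K <= \sum_l (\sum_j g (f l) (f j)) ^+ 2 + K * (sample_cycles f)%:R.
  have [/acyclic_sample_deviation h|B0] := posnP (sample_cycles f).
    by apply: le_trans h _; rewrite lerDl mulr_ge0 ?ler0n // ltW.
  rewrite -[leLHS]add0r lerD ?sumr_ge0 // => [l _|]; first exact: sqr_ge0.
  by apply: ler_peMr; [exact: ltW|rewrite ler1n].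
have total : F * K <= F * (m%:R ^+ 2 * #|V|%:R ^+ 2)
    + K * (\sum_f (sample_cycles f)%:R).
  rewrite mulr_natl -sumr_const.
  apply: le_trans (ler_sum _ (fun f _ => each f)) _.
  rewrite big_split /= -big_distrr lerD2r.
  have := @sum_sqr_deviation 'I_m V g #|V|%:R V0 (ltW N0) g_sum g_bound.
  by rewrite card_ord.
have Kbig : 2 * (m%:R ^+ 2 * #|V|%:R ^+ 2) <= K.
  rewrite (_ : K = eta ^+ 3 * m%:R * (m%:R ^+ 2 * #|V|%:R ^+ 2)); last first.
    by rewrite /K; ring.
  by rewrite ler_wpM2r ?mulr_ge0 ?exprn_ge0 ?ltW.
have half : F <= 2 * \sum_f (sample_cycles f)%:R.
  rewrite -(ler_pM2l K0).
  have : F * (2 * (m%:R ^+ 2 * #|V|%:R ^+ 2)) <= F * K.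
    by rewrite ler_pM2l.
  lra.
have sum_dig : #|V|%:R ^+ 2 * (\sum_(f : {ffun 'I_m -> V})
    (digons (fun i j => e (f i) (f j)))%:R) <= F * (m%:R ^+ 2 * (digons e)%:R).
  pose ind x y : rat := (e x y && e y x)%:R.
  have cE : (digons e)%:R = \sum_x \sum_y ind x y.
    by rewrite natr_sum; apply: eq_bigr => x _; rewrite natr_sum.
  have step i j : #|V|%:R ^+ 2 * \sum_(f : {ffun 'I_m -> V}) ind (f i) (f j)
      <= F * (digons e)%:R.
    have [<-|ij] := eqVneq i j.
      rewrite big1 ?mulr0 ?mulr_ge0 ?ler0n ?ltW // => f _.
      by rewrite /ind irr.
    by rewrite expr2 -mulrA sum_pair // cE.
  under eq_bigr => f _ do (rewrite natr_sum; under eq_bigr => i _ do rewrite natr_sum).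
  have -> : F * (m%:R ^+ 2 * (digons e)%:R)
      = #|'I_m|%:R * (#|'I_m|%:R * (F * (digons e)%:R)) by rewrite card_ord; ring.
  rewrite exchange_big /= big_distrr /=; apply: ler_sum_card => i.
  rewrite exchange_big /= big_distrr /=; apply: ler_sum_card => j.
  exact: step.
have sum_tri : #|V|%:R ^+ 3 * (\sum_(f : {ffun 'I_m -> V})
    (cyclic_triangles (fun i j => e (f i) (f j)))%:R)
    <= F * (m%:R ^+ 3 * (cyclic_triangles e)%:R).
  pose ind x y z : rat := [&& e x y, e y z & e z x]%:R.
  have cE : (cyclic_triangles e)%:R = \sum_x \sum_y \sum_z ind x y z.
    rewrite natr_sum; apply: eq_bigr => x _; rewrite natr_sum.
    by apply: eq_bigr => y _; rewrite natr_sum.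
  have step i j l :
      #|V|%:R ^+ 3 * \sum_(f : {ffun 'I_m -> V}) ind (f i) (f j) (f l)
      <= F * (cyclic_triangles e)%:R.
    have [/and3P[ij il jl]|eq_ijl] := boolP [&& i != j, i != l & j != l].
      by rewrite !exprS expr0 mulr1 -!mulrA sum_triple // cE.
    rewrite big1 ?mulr0 ?mulr_ge0 ?ler0n ?ltW // => f _.
    move: eq_ijl; rewrite !negb_and !negbK /ind => /or3P[] /eqP->;
      by rewrite irr ?andbF.
  under eq_bigr => f _ do (rewrite natr_sum; under eq_bigr => i _ do
    (rewrite natr_sum; under eq_bigr => j _ do rewrite natr_sum)).
  have -> : F * (m%:R ^+ 3 * (cyclic_triangles e)%:R) = #|'I_m|%:R *
      (#|'I_m|%:R * (#|'I_m|%:R * (F * (cyclic_triangles e)%:R))).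
    by rewrite card_ord; ring.
  rewrite exchange_big /= big_distrr /=; apply: ler_sum_card => i.
  rewrite exchange_big /= big_distrr /=; apply: ler_sum_card => j.
  rewrite exchange_big /= big_distrr /=; apply: ler_sum_card => l.
  exact: step.
have castE (a b x y : nat) : ((2 * (m ^ a * x + m ^ b * y))%N%:R : rat)
    = 2 * (m%:R ^+ a * x%:R + m%:R ^+ b * y%:R).
  by rewrite natrM natrD !natrM !natrX.
rewrite -(ler_nat rat) -(ler_pM2l F0) castE natrX natrM.
apply: le_trans (_ : #|V|%:R ^+ 3 * (2 * \sum_f (sample_cycles f)%:R) <= _).
  by rewrite mulrC ler_pM2l ?exprn_gt0.
under eq_bigr => f _ do rewrite natrD.
rewrite big_split /=.
have := ler_wpM2l (ltW N0) sum_dig.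
nra.
Qed.
End Sampling.

Local Close Scope ring_scope.

(** * Triple systems without loose paths *)

Lemma card3_mem (V : finType) (e : {set V}) v : #|e| = 3 -> v \in e ->
  exists a b, [/\ e = [set v; a; b], v != a, v != b & a != b].
Proof.
move=> e3 ve; have E2 : #|e :\ v| == 2 by move: e3; rewrite (cardsD1 v) ve add1n => -[->].
move/cards2P: E2 => [a [b [ab Eab]]]; exists a, b.
have : a \in e :\ v by rewrite Eab !inE eqxx.
have : b \in e :\ v by rewrite Eab !inE eqxx orbT.
rewrite !inE ![_ == v]eq_sym => /andP[vb _] /andP[va _]; split => //.
by rewrite -(setD1K ve) Eab setUA.
Qed.

Lemma set3CA (V : finType) (a b c : V) : [set a; b; c] = [set b; a; c].
Proof. by rewrite [[set a; b]]setUC. Qed.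

Lemma set3AC (V : finType) (a b c : V) : [set a; b; c] = [set a; c; b].
Proof. by rewrite setUAC. Qed.

Lemma cards3 (V : finType) (a b c : V) :
  a != b -> a != c -> b != c -> #|[set a; b; c]| = 3.
Proof.
by move=> ab ac bc; rewrite -setUA cardsU1 !inE negb_or ab ac cards2 bc.
Qed.

Lemma leq_card_set4 (V : finType) (a b c d : V) : #|[set a; b; c; d]| <= 4.
Proof.
have [+ _] := leq_card_setU [set a; b; c] [set d].
have [+ _] := leq_card_setU [set a; b] [set c]; rewrite !cards1 cards2; lia.
Qed.

Lemma leq_card_bigcup (I T : finType) (A : {set I}) (F : I -> {set T}) :
  #|\bigcup_(i in A) F i| <= \sum_(i in A) #|F i|.
Proof.
apply: (big_rec2 (fun (B : {set T}) n => #|B| <= n)); first by rewrite cards0.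
move=> i n B _ Bn; rewrite cardsU; apply: leq_trans (leq_subr _ _) _.
by rewrite leq_add2l.
Qed.

Lemma contains_loose_path (V : finType) (H : hypergraph V) x y z e1 e3 :
  e1 \in H -> [set x; y; z] \in H -> e3 \in H -> #|e1| = 3 -> #|e3| = 3 ->
  [/\ x != y, x != z & y != z] ->
  [/\ x \in e1, y \notin e1 & z \notin e1] ->
  [/\ y \in e3, x \notin e3 & z \notin e3] ->
  [disjoint e1 & e3] -> contains_copy loose_path H.
Proof.
move=> e1H e2H e3H c1 c3 [xy xz yz] [xe1 ye1 ze1] [ye3 xe3 ze3] dis.
have [a [b [E1 xa xb ab]]] := card3_mem c1 xe1.
have [c [d [E3 yc yd cd]]] := card3_mem c3 ye3.
have dneq u w : u \in e1 -> w \in e3 -> u != w.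
  move=> ue we; apply: contraTneq ue => ->.
  by rewrite (disjointFl dis we).
have [ac ad bc bd] : [/\ a != c, a != d, b != c & b != d].
  by split; apply: dneq; rewrite ?E1 ?E3 !inE eqxx ?orbT.
have [xc xd] : x != c /\ x != d by split; apply: dneq; rewrite ?E1 ?E3 !inE eqxx ?orbT.
have [ay by_] : a != y /\ b != y by split; apply: dneq; rewrite ?E1 ?E3 !inE eqxx ?orbT.
move: ze1 ze3; rewrite E1 E3 !inE !negb_or -!andbA => /and3P[_ za zb] /and3P[_ zc zd].
(* The vertices in path order, with the two joints [x] and [y] at positions 2 and 4. *)
pose s := [:: a; b; x; z; y; c; d].
have us : uniq s.
  rewrite /s /= !inE !negb_or ab ![a == x]eq_sym xa [a == z]eq_sym za ay ac ad.
  rewrite [b == x]eq_sym xb [b == z]eq_sym zb by_ bc bd xz xy xc xd.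
  by rewrite [z == y]eq_sym yz zc zd yc yd cd.
exists (fun i : 'I_7 => nth x s i).
  move=> i j /eqP; by rewrite nth_uniq // => /eqP /val_inj.
move=> e; rewrite !inE -orbA => /or3P[] /eqP->; rewrite !imsetU !imset_set1 !inordK //=.
- by rewrite set3AC set3CA -E1.
- by rewrite set3AC.
- by rewrite -E3.
Qed.

Definition edges_at (V : finType) (H : hypergraph V) (v : V) : hypergraph V :=
  [set e in H | v \in e].

(** Maximise [weight] over subsystems. Removing all edges at a non-isolated vertex of degree below
    [C] would lose fewer than [C] edges and gain an isolated vertex; comparison with [H] bounds the
    deleted edges. *)
Lemma exists_core (V : finType) (H : hypergraph V) (C : nat) :
  exists H1 : hypergraph V, [/\ H1 \subset H,
    forall v, edges_at H1 v != set0 -> C <= #|edges_at H1 v|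
    & #|H :\: H1| <= C * #|V|].
Proof.
pose isolated (K : hypergraph V) := [set v | edges_at K v == set0].
pose weight (K : hypergraph V) := C * #|isolated K| + #|K|.
case: (@arg_maxnP _ H (fun K => K \subset H) weight (subxx H)) => K KH Kmax.
exists K; split=> // [v vK|].
  rewrite leqNgt; apply/negP => small.
  have vNK : edges_at (K :\: edges_at K v) v == set0.
    by apply/eqP/setP=> e; rewrite !inE; case: (e \in K); case: (v \in e).
  have := Kmax (K :\: edges_at K v) (subset_trans (subsetDl _ _) KH).
  have EK : edges_at K v \subset K by apply/subsetP=> e; rewrite inE => /andP[].
  have c1 : #|K| = #|edges_at K v| + #|K :\: edges_at K v|.
    by rewrite -[LHS](cardsID (edges_at K v)) (setIidPr EK).
  have c2 : #|isolated K| < #|isolated (K :\: edges_at K v)|.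
    apply: proper_card; apply/properP; split.
      apply/subsetP=> u; rewrite !inE => /eqP uK; apply/eqP/setP=> e.
      have /setP/(_ e) := uK; rewrite !inE.
      by case: (e \in K); case: (u \in e); case: (v \in e).
    by exists v; rewrite inE.
  rewrite /weight; nia.
have := Kmax H (subxx H); rewrite /weight cardsD (setIidPr KH).
have : #|isolated K| <= #|V| by apply: max_card.
nia.
Qed.

(** * Domination in path-free triple systems of large degree *)

Section Core.
Variables (V : finType) (H : hypergraph V).
Hypothesis H3 : uniform3 H.
Hypothesis Hfree : ~ contains_copy loose_path H.
Hypothesis Hdeg : forall v, edges_at H v != set0 -> 100 <= #|edges_at H v|.

(** Requiring an edge at [v] keeps an isolated vertex from being dominated by every other vertex. *)
Definition dominates (v z : V) : bool :=
  [&& v != z, edges_at H v != set0 & [forall e in edges_at H v, z \in e]].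

Lemma dominatesP v z : reflect
  [/\ v != z, edges_at H v != set0 & forall e, e \in H -> v \in e -> z \in e]
  (dominates v z).
Proof.
apply: (iffP and3P) => -[vz v0 h]; split => //.
  by move=> e eH ve; apply: (forall_inP h); rewrite inE eH.
by apply/forall_inP => e; rewrite inE => /andP[]; apply: h.
Qed.

Definition coneighbours (v p : V) : {set V} :=
  [set w | [&& w != v, w != p & [set v; p; w] \in H]].

(* The sets S play the role of the other vertices of two edges f and
   {v, a, b} with f containing a: a rich vertex has an edge completing them to
   a loose path. *)
Definition rich (v : V) : bool :=
  [forall S : {set V}, (#|S| <= 4) && (v \notin S) ==>
    [exists e in edges_at H v, [disjoint e & S]]].

Lemma richP v : reflect
  (forall S : {set V}, #|S| <= 4 -> v \notin S ->
     exists e, [/\ e \in H, v \in e & [disjoint e & S]]) (rich v).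
Proof.
apply: (iffP forallP) => h S.
  move=> S4 vS; have := h S; rewrite S4 vS /= => /exists_inP[e].
  by rewrite inE => /andP[? ?] ?; exists e.
apply/implyP => /andP[S4 vS]; have [e [eH ve eS]] := h S S4 vS.
by apply/exists_inP; exists e => //; rewrite inE eH.
Qed.

Lemma edge_at e v : e \in H -> v \in e -> edges_at H v != set0.
Proof. by move=> eH ve; apply/set0Pn; exists e; rewrite inE eH. Qed.

Lemma three_edges e1 e2 e3 v : edges_at H v \subset [set e1; e2; e3] ->
  edges_at H v = set0.
Proof.
move=> sub; apply/eqP; apply: contraT => /Hdeg.
move/leq_trans/(_ (subset_leq_card sub)).
have [+ _] := leq_card_setU [set e1; e2] [set e3]; rewrite cards1 cards2; lia.
Qed.

(** Two different dominating vertices would leave {v, z, z'} as the only edge at [v]. *)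
Lemma dominates_inj v z z' : dominates v z -> dominates v z' -> z = z'.
Proof.
move=> /dominatesP[vz v0 dz] /dominatesP[vz' _ dz'].
apply/eqP; apply: contraT => zz'.
move/eqP: v0; case; apply: (@three_edges [set v; z; z'] [set v; z; z'] [set v; z; z']).
apply/subsetP=> e; rewrite !inE => /andP[eH ve]; rewrite !orbb eq_sym eqEcard.
rewrite H3 // cards3 // leqnn andbT.
by apply/subsetP => x; rewrite !inE => /orP[/orP[]|] /eqP-> //; [exact: dz|exact: dz'].
Qed.

(** Each of the at least 100 edges at [v] contains one of at most four vertices of [S], so one of
    these lies in at least 25 of them. *)
Lemma exists_heavy_pair v (S : {set V}) :
  #|S| <= 4 -> v \notin S -> edges_at H v != set0 ->
  (forall e, e \in H -> v \in e -> ~~ [disjoint e & S]) ->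
  exists2 p, p \in S & 25 <= #|coneighbours v p|.
Proof.
move=> S4 vS v0 cov; apply/exists_inP; apply: contraT => /exists_inPn light.
have := Hdeg v0; apply: contraTT => _; rewrite -ltnNge.
have sub : edges_at H v \subset
    \bigcup_(p in S) [set [set v; p; w] | w in coneighbours v p].
  apply/subsetP=> e; rewrite inE => /andP[eH ve].
  have := cov e eH ve; rewrite -setI_eq0 => /set0Pn[p /setIP[pe pS]].
  have [a [b [E va vb ab]]] := card3_mem (H3 eH) ve.
  apply/bigcupP; exists p => //; apply/imsetP.
  have vp : v != p by apply: contraNneq vS => ->.
  move: pe; rewrite E !inE [p == v]eq_sym (negPf vp) /= => /orP[]/eqP pE.
    by exists b; rewrite ?inE pE // [b == v]eq_sym vb [b == a]eq_sym ab -E.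
  exists a; last by rewrite pE -!setUA [[set a] :|: _]setUC.
  by rewrite !inE pE [a == v]eq_sym va ab -setUA [[set b] :|: _]setUC setUA -E.
apply: leq_ltn_trans (subset_leq_card sub) _.
apply: leq_ltn_trans (leq_card_bigcup _ _) _.
apply: (@leq_ltn_trans (\sum_(p in S) 24)).
  apply: leq_sum => p pS; apply: leq_trans (leq_imset_card _ _) _.
  by have := light p pS; rewrite -ltnNge.
by rewrite sum_nat_const; lia.
Qed.

(** Otherwise richness yields an edge [g] at [v] avoiding the four vertices of [b |: f], and [g],
    {v, a, b}, [f] form a loose path. *)
Lemma rich_neighbour v a b f : rich v -> [set v; a; b] \in H ->
  [/\ v != a, v != b & a != b] -> f \in H -> a \in f -> v \notin f -> b \in f.
Proof.
move=> /richP rv eH [va vb ab] fH af vf; apply: contraT => bf.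
have [||g [gH vg dg]] := rv (b |: f).
- by rewrite cardsU1 bf H3.
- by rewrite !inE negb_or vb.
have gdis x : x \in b |: f -> x \notin g by move=> xf; rewrite (disjointFl dg xf).
case: Hfree; apply: (@contains_loose_path V H v a b g f) => //; try exact: H3.
- by split=> //; apply: gdis; rewrite !inE ?eqxx ?af ?orbT.
- exact: disjointWr (subsetUr [set b] f) dg.
Qed.

(* A second neighbour of a in the link of v would lie in f as well, leaving at
   most three edges at a. *)
Lemma rich_dominates v a b f : rich v -> [set v; a; b] \in H ->
  [/\ v != a, v != b & a != b] -> f \in H -> a \in f -> v \notin f ->
  dominates a b.
Proof.
move=> rv eH [va vb ab] fH af vf; apply/dominatesP; split=> //.
  exact: edge_at fH af.
have bf := rich_neighbour rv eH (And3 va vb ab) fH af vf.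
move=> e eH' ae; have [ve|ve] := boolP (v \in e); last first.
  exact: rich_neighbour rv eH (And3 va vb ab) eH' ae ve.
apply: contraT => be.
have [x [y [E ax ay xy]]] := card3_mem (H3 eH') ae.
have [w [wa wv Ew]] : exists w, [/\ w != a, w != v & e = [set v; a; w]].
  move: ve; rewrite E !inE (negPf va) /= => /orP[] /eqP vE.
    exists y; rewrite vE [y == a]eq_sym [y == x]eq_sym; split=> //.
    by rewrite set3CA.
  exists x; rewrite vE [x == a]eq_sym; split=> //.
  by rewrite [[set y; a]]setUC -!setUA [[set x] :|: _]setUC.
have wb : w != b by apply: contraNneq be => <-; rewrite Ew !inE eqxx orbT.
have eHw : [set v; a; w] \in H by rewrite -Ew.
have in_f g : g \in H -> a \in g -> v \notin g -> g = [set a; b; w].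
  move=> gH ag vg; apply/eqP; rewrite eq_sym eqEcard.
  rewrite H3 // cards3 // 1?eq_sym // leqnn andbT.
  apply/subsetP=> x'; rewrite !inE => /orP[/orP[]|] /eqP-> //.
    exact: rich_neighbour rv eH (And3 va vb ab) gH ag vg.
  have vw : v != w by rewrite eq_sym.
  have aw : a != w by rewrite eq_sym.
  exact: rich_neighbour rv eHw (And3 va vw aw) gH ag vg.
have fE := in_f f fH af vf.
suff : edges_at H a = set0.
  by move=> h; have := edge_at fH af; rewrite h eqxx.
apply: (@three_edges [set v; a; b] [set v; a; w] [set a; b; w]).
apply/subsetP=> g; rewrite !inE => /andP[gH ag].
have [vg|vg] := boolP (v \in g); last by rewrite (in_f g) // eqxx orbT.
have [z [za zv Eg]] : exists z, [/\ z != a, z != v & g = [set v; a; z]].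
  have [x' [y' [E' ax' ay' xy']]] := card3_mem (H3 gH) ag.
  move: vg; rewrite E' !inE (negPf va) /= => /orP[] /eqP vE.
    exists y'; rewrite vE [y' == a]eq_sym [y' == x']eq_sym; split=> //.
    by rewrite [[set x'; a]]setUC.
  exists x'; rewrite vE [x' == a]eq_sym; split=> //.
  by rewrite [[set y'; a]]setUC -!setUA [[set x'] :|: _]setUC.
have zf : z \in f.
  have gHz : [set v; a; z] \in H by rewrite -Eg.
  by apply: rich_neighbour rv gHz _ fH af vf; split=> //; rewrite eq_sym.
move: zf; rewrite fE !inE (negPf za) /= => /orP[] /eqP zE; rewrite Eg zE eqxx ?orbT //.
Qed.

(* If some edge e3 at v avoids the heavy partner p, then many w have their edges
   covered by {v, p} and e3, so one of these vertices is rich; each choice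
   contradicts [rich_neighbour]. *)
Lemma poor_dominates v : ~~ rich v -> edges_at H v != set0 ->
  exists p, dominates v p.
Proof.
move=> pv v0.
have [S [S4 vS cov]] : exists S : {set V}, [/\ #|S| <= 4, v \notin S
    & forall e, e \in H -> v \in e -> ~~ [disjoint e & S]].
  move: pv => /forallPn[S]; rewrite negb_imply => /andP[/andP[S4 vS]].
  move=> /exists_inPn h; exists S; split=> // e eH ve; apply: h.
  by rewrite inE eH.
have [p pS Wbig] := exists_heavy_pair S4 vS v0 cov.
have vp : v != p by apply: contraNneq vS => ->.
exists p; apply/dominatesP; split=> // e3 e3H ve3; apply: contraT => pe3.
have [a [b [E3 va vb ab]]] := card3_mem (H3 e3H) ve3.
have [pa pb] : p != a /\ p != b.
  by move: pe3; rewrite E3 !inE !negb_or -andbA => /and3P[_ -> ->].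
pose W := coneighbours v p :\: [set a; b].
have W23 : 23 <= #|W|.
  move: Wbig; rewrite -(cardsID [set a; b]) -/W.
  have := subset_leq_card (subsetIr (coneighbours v p) [set a; b]).
  rewrite cards2 ab => i2 /leq_trans h.
  by rewrite -(leq_add2l 2); apply: h; rewrite leq_add2r.
have WP w : w \in W -> [/\ w != v, w != p, w != a, w != b & [set v; p; w] \in H].
  by rewrite !inE negb_or => /andP[/andP[-> ->] /and3P[-> -> ->]].
pose Q := [set v; p; a; b].
have Q4 : #|Q| <= 4 by exact: leq_card_set4.
(* An edge [f] at [w] missing [Q] would give the loose path [f], {w, v, p}, [e3]. *)
have heavy w : w \in W -> exists2 u, u \in Q & 25 <= #|coneighbours w u|.
  move=> /WP[wv wp wa wb wH]; apply: exists_heavy_pair => //.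
  - by rewrite !inE !negb_or wv wp wa wb.
  - by apply: edge_at wH _; rewrite !inE eqxx orbT.
  move=> f fH wf; apply/negP => dis.
  have nf x : x \in Q -> x \notin f by move=> xQ; rewrite (disjointFl dis xQ).
  case: Hfree; apply: (@contains_loose_path V H w v p f e3) => //.
  - by rewrite -setUA setUC.
  - exact: H3.
  - exact: H3.
  - by split=> //; apply: nf; rewrite !inE eqxx ?orbT.
  - by split=> //; rewrite E3 !inE !negb_or wv wa.
  - rewrite disjoint_sym; apply: disjointWl (_ : [disjoint Q & f]); last first.
      by rewrite disjoint_sym.
    apply/subsetP=> x; rewrite E3 !inE => /orP[/orP[]|] ->; rewrite ?orbT //.
pose Wu u := [set w in W | 25 <= #|coneighbours w u|].
(* Pigeonhole: 23 > 4 * 4. Five choices of [w] and 25 of the third vertex then suffice to avoid any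
   four vertices, which makes [u] rich. *)
have [u uQ Wu5] : exists2 u, u \in Q & 5 <= #|Wu u|.
  apply/exists_inP; apply: contraT => /exists_inPn small.
  have sub : W \subset \bigcup_(u in Q) Wu u.
    apply/subsetP=> w wW; have [u uQ hu] := heavy w wW.
    by apply/bigcupP; exists u => //; rewrite inE wW.
  have le16 : \sum_(u in Q) #|Wu u| <= 4 * 4.
    apply: leq_trans (leq_mul Q4 (leqnn 4)); rewrite -sum_nat_const.
    by apply: leq_sum => u /small; rewrite -ltnNge.
  by have := leq_trans (subset_leq_card sub) (leq_trans (leq_card_bigcup _ _) le16);
    rewrite leqNgt (leq_trans _ W23).
have ru : rich u.
  apply/richP => S' S'4 uS'.
  have [w wWu wS'] : exists2 w, w \in Wu u & w \notin S'.
    by apply/subsetPn; apply/negP => /subset_leq_card /leq_trans /(_ S'4) /(leq_trans Wu5).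
  move: wWu; rewrite inE => /andP[wW wu].
  have [y yN yS'] : exists2 y, y \in coneighbours w u & y \notin S'.
    by apply/subsetPn; apply/negP => /subset_leq_card /leq_trans /(_ S'4) /(leq_trans wu).
  move: yN; rewrite !inE => /and3P[yw yu yH].
  exists [set w; u; y]; split=> //; first by rewrite !inE eqxx orbT.
  rewrite -setI_eq0; apply/eqP/setP => x; rewrite !inE; apply/negP.
  by case/andP=> /orP[/orP[]|] /eqP->; apply/negP.
have [w wW] : exists w, w \in W by apply/card_gt0P; apply: leq_trans W23.
have [wv wp wa wb wH] := WP w wW.
have we3 : w \notin e3 by rewrite E3 !inE !negb_or wv wa wb.
have vf : v \in [set v; p; w] by rewrite !inE eqxx.
(* If [u] is [p], the edges {p, v, w} and [e3] force [w] into [e3]; if [u] is [a] or [b], the edges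
   [e3] and {v, p, w} force the other of the two into {v, p, w}. *)
move: uQ ru; rewrite !inE -!orbA => /or4P[] /eqP-> ru.
- by rewrite ru in pv.
- move/negP: we3; case; apply: (rich_neighbour ru _ _ e3H ve3 pe3).
    by rewrite set3CA.
  by split; rewrite eq_sym // eq_sym.
- have : b \in [set v; p; w].
    apply: (rich_neighbour ru _ _ wH vf); first by rewrite set3CA -E3.
      by split=> //; rewrite eq_sym.
    by rewrite !inE !negb_or [a == v]eq_sym va [a == p]eq_sym pa [a == w]eq_sym.
  by rewrite !inE [b == v]eq_sym (negPf vb) [b == p]eq_sym (negPf pb) [b == w]eq_sym (negPf wb).
- have : a \in [set v; p; w].
    apply: (rich_neighbour ru _ _ wH vf); first by rewrite set3CA set3AC -E3.
      by split=> //; rewrite eq_sym.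
    by rewrite !inE !negb_or [b == v]eq_sym vb [b == p]eq_sym pb [b == w]eq_sym.
  by rewrite !inE [a == v]eq_sym (negPf va) [a == p]eq_sym (negPf pa) [a == w]eq_sym (negPf wa).
Qed.

(** An edge avoiding [v] and meeting {a, b} contains both and makes them dominate each other; if
    there is none, [v] dominates both. *)
Lemma rich_edge v a b : rich v -> [set v; a; b] \in H ->
  [/\ v != a, v != b & a != b] ->
  dominates a b /\ dominates b a \/ dominates a v /\ dominates b v.
Proof.
move=> rv eH [va vb ab].
have eH' : [set v; b; a] \in H by rewrite set3AC.
have dist' : [/\ v != b, v != a & b != a] by rewrite eq_sym in ab.
have [a0 b0] : edges_at H a != set0 /\ edges_at H b != set0.
  by split; apply: edge_at eH _; rewrite !inE eqxx ?orbT.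
have [/existsP[f /and3P[fH af vf]]|noa] :=
    boolP [exists f : {set V}, [&& f \in H, a \in f & v \notin f]].
  have bf := rich_neighbour rv eH (And3 va vb ab) fH af vf.
  left; split; first exact: rich_dominates rv eH (And3 va vb ab) fH af vf.
  exact: rich_dominates rv eH' dist' fH bf vf.
have [/existsP[f /and3P[fH bf vf]]|nob] :=
    boolP [exists f : {set V}, [&& f \in H, b \in f & v \notin f]].
  have af := rich_neighbour rv eH' dist' fH bf vf.
  by case/existsP: noa; exists f; rewrite fH af vf.
have [av bv] : a != v /\ b != v by split; rewrite eq_sym.
right; split; apply/dominatesP; split=> // e eE ve.
  by move/existsPn/(_ e): noa; rewrite eE ve /= negbK.
by move/existsPn/(_ e): nob; rewrite eE ve /= negbK.
Qed.

Lemma no_cyclic_domination x y z : [set x; y; z] \in H ->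
  [/\ x != y, x != z & y != z] ->
  dominates x y -> dominates y z -> dominates z x -> False.
Proof.
move=> eH [xy xz yz] /dominatesP[_ x0 dx] /dominatesP[_ _ dy] _.
move/eqP: x0; apply; apply: (@three_edges [set x; y; z] [set x; y; z] [set x; y; z]).
apply/subsetP=> e; rewrite !inE => /andP[eE xe]; rewrite !orbb eq_sym eqEcard.
rewrite H3 // cards3 // leqnn andbT; have ye := dx e eE xe.
by apply/subsetP => u; rewrite !inE => /orP[/orP[]|] /eqP-> //; exact: dy.
Qed.

(** If no vertex is rich, each is dominated by another vertex of the edge. A fixed-point-free map on
    three points is a 3-cycle, excluded by [no_cyclic_domination], or has a mutual pair. *)
Lemma edge_structure x y z : [set x; y; z] \in H ->
  [/\ x != y, x != z & y != z] ->
  [|| dominates x y && dominates y x, dominates x z && dominates z x,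
      dominates y z && dominates z y, dominates y x && dominates z x,
      dominates x y && dominates z y | dominates x z && dominates y z].
Proof.
move=> eH dist; have [xy xz yz] := dist.
have [yx zx zy] : [/\ y != x, z != x & z != y] by split; rewrite eq_sym.
have [rx|px] := boolP (rich x).
  by case: (rich_edge rx eH dist) => -[-> ->]; rewrite ?orbT.
have [ry|py] := boolP (rich y).
  have eH' : [set y; x; z] \in H by rewrite set3CA.
  by case: (rich_edge ry eH' (And3 yx yz xz)) => -[-> ->]; rewrite ?orbT.
have [rz|pz] := boolP (rich z).
  have eH' : [set z; x; y] \in H by rewrite set3CA set3AC.
  by case: (rich_edge rz eH' (And3 zx zy xy)) => -[-> ->]; rewrite ?orbT.
have [[p dx] [q dy] [t dz]] :
    [/\ exists p, dominates x p, exists q, dominates y q & exists t, dominates z t].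
  by split; apply: poor_dominates => //; apply: edge_at eH _; rewrite !inE eqxx ?orbT.
have := And3 dx dy dz.
have mem v u : dominates v u -> v \in [set x; y; z] -> u \in [set x; y; z] :\ v.
  by move=> /dominatesP[vu _ d] ve; rewrite in_setD1 eq_sym vu d.
have := mem _ _ dx; have := mem _ _ dy; have := mem _ _ dz.
rewrite !inE !eqxx ?orbT /= => /(_ isT)/andP[/negPf tz ht] /(_ isT)/andP[/negPf qy hq].
move=> /(_ isT)/andP[/negPf px' hp].
move: hp hq ht; rewrite tz qy px' /= orbF orbF.
have cyc1 : dominates x y -> dominates y z -> dominates z x -> False.
  exact: no_cyclic_domination eH dist.
have cyc2 : dominates x z -> dominates z y -> dominates y x -> False.
  by apply: no_cyclic_domination; rewrite 1?set3AC.
move=> /orP[]/eqP-> /orP[]/eqP-> /orP[]/eqP-> [hx hy hz];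
  rewrite ?hx ?hy ?hz ?orbT //; first by case: cyc1.
by case: cyc2.
Qed.

(** In every alternative of [edge_structure] left, [z] dominates [x] or [y], so [z] lies in each
    edge containing both. *)
Lemma nonadjacent_edge_inj x y z z' :
  ~~ dominates x y -> ~~ dominates y x ->
  [set x; y; z] \in H -> [set x; y; z'] \in H ->
  [/\ x != y, x != z & y != z] -> [/\ x != y, x != z' & y != z'] -> z = z'.
Proof.
move=> /negPf nxy /negPf nyx eH eH' dist [_ xz' yz'].
have [xy xz yz] := dist; apply/eqP.
suff : z \in [set x; y; z'] by rewrite !inE ![z == _]eq_sym (negPf xz) (negPf yz) eq_sym.
have := edge_structure eH dist; rewrite nxy nyx /= ?andbF /=.
have xin : x \in [set x; y; z'] by rewrite !inE eqxx.
have yin : y \in [set x; y; z'] by rewrite !inE eqxx ?orbT.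
by move=> /or3P[] /andP[/dominatesP[_ _ d1] /dominatesP[_ _ d2]];
  solve [exact: d1 | exact: d2].
Qed.

End Core.

(** * Colourings *)

Section Coloring.
Variables (n k : nat) (K : 'I_k -> hypergraph 'I_n) (L : hypergraph 'I_n).
Hypothesis K3 : forall i, uniform3 (K i).
Hypothesis L3 : uniform3 L.
Hypothesis Kfree : forall i, ~ contains_copy loose_path (K i).
Hypothesis Kdeg :
  forall i v, edges_at (K i) v != set0 -> 100 <= #|edges_at (K i) v|.
Hypothesis cover : forall E : {set 'I_n}, #|E| = 3 ->
  E \in L \/ exists i, E \in K i.

Definition undominated : rel 'I_n :=
  fun x y => (x != y) && ~~ [exists i, dominates (K i) x y].

(** The vertices missed are [x] and at most one dominating vertex per colour. *)
Lemma undominated_outdegree x : n <= #|outs undominated x| + k.+1.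
Proof.
have sub : [set: 'I_n] \subset
    outs undominated x :|: (x |: \bigcup_(i in [set: 'I_k]) [set y | dominates (K i) x y]).
  apply/subsetP=> y _; rewrite !inE /undominated eq_sym.
  have [//|_ /=] := eqVneq y x.
  have [/existsP[i iy]|//] := boolP [exists i, dominates (K i) x y].
  by apply/bigcupP; exists i; rewrite inE.
have := subset_leq_card sub; rewrite cardsT card_ord => /leq_trans; apply.
have [h _] := leq_card_setU (outs undominated x)
  (x |: \bigcup_(i in [set: 'I_k]) [set y | dominates (K i) x y]).
apply: leq_trans h _; rewrite leq_add2l cardsU1.
apply: (@leq_add _ _ 1); first by case: (_ \notin _).
apply: leq_trans (leq_card_bigcup _ _) _.
rewrite -[X in _ <= X]card_ord -cardsT -sum1_card; apply: leq_sum => i _.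
apply/card_le1_eqP => y y'; rewrite !inE => xy xy'.
exact: (dominates_inj (@K3 i) (@Kdeg i) xy' xy).
Qed.

Definition bad_triple (x y z : 'I_n) : bool := (x != y) && ([set x; y; z] \in L).

Lemma sum_bad_triples : \sum_x \sum_y \sum_z bad_triple x y z <= 27 * #|L|.
Proof.
have le x y z : (bad_triple x y z : nat) <=
    \sum_(E in L) (x \in E) * ((y \in E) * (z \in E)).
  rewrite /bad_triple; have [EL|] := boolP ([set x; y; z] \in L); last by rewrite andbF.
  by rewrite (bigD1 [set x; y; z]) //= !inE !eqxx ?orbT; case: (_ != _).
apply: leq_trans (_ : \sum_x \sum_y \sum_z
  \sum_(E in L) (x \in E) * ((y \in E) * (z \in E)) <= _).
  by do 3 (apply: leq_sum => ? _).
under eq_bigr => x _ do under eq_bigr => y _ do rewrite exchange_big /=.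
under eq_bigr => x _ do rewrite exchange_big /=.
rewrite exchange_big mulnC -sum_nat_const; apply: leq_sum => E EL.
have cE : \sum_x (x \in E) = 3.
  by rewrite -(L3 EL) -sum1_card [RHS]big_mkcond; apply: eq_bigr => x _; case: (x \in E).
under eq_bigr => x _.
  under eq_bigr => y _ do rewrite -!big_distrr cE /=.
  rewrite -big_distrr -big_distrl cE /=.
  over.
by rewrite -big_distrl cE.
Qed.

(** Each alternative of [edge_structure] contains a domination along one of the arcs of the cycle,
    so the triple lies in no [K i] and must be in [L]. *)
Lemma undominated_triangles :
  cyclic_triangles undominated <= \sum_x \sum_y \sum_z bad_triple x y z.
Proof.
apply: leq_sum => x _; apply: leq_sum => y _; apply: leq_sum => z _.
case: and3P => // -[/andP[xy nxy] /andP[yz nyz] /andP[zx nzx]].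
rewrite lt0b /bad_triple xy /=.
have dist : [/\ x != y, x != z & y != z] by rewrite xy yz eq_sym zx.
have E3 : #|[set x; y; z]| = 3 by case: dist => ? ? ?; apply: cards3.
have [//|[i iE]] := cover E3.
have no u v : ~~ [exists j, dominates (K j) u v] -> dominates (K i) u v = false.
  by move/existsPn/(_ i)/negPf.
have := edge_structure (@K3 i) (@Kfree i) (@Kdeg i) iE dist.
by rewrite (no _ _ nxy) (no _ _ nyz) (no _ _ nzx) ?andbF.
Qed.

(** For a 2-cycle x, y the n vertices z split into bad ones, at most one per colour by
    [nonadjacent_edge_inj], and x, y themselves. *)
Lemma undominated_digons :
  digons undominated * n
    <= \sum_x \sum_y \sum_z bad_triple x y z + digons undominated * (k + 2).
Proof.
rewrite /digons !big_distrl -big_split; apply: leq_sum => x _ /=.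
rewrite !big_distrl -big_split; apply: leq_sum => y _ /=.
case: andP => [[/andP[xy nxy] /andP[_ nyx]]|_]; last by rewrite !mul0n leq0n.
rewrite !mul1n.
pose B := [set z | bad_triple x y z].
have -> : \sum_z bad_triple x y z = #|B|.
  rewrite -sum1_card [RHS]big_mkcond; apply: eq_bigr => z _; rewrite inE.
  by case: (bad_triple x y z).
pose W i := [set z | [&& x != z, y != z & [set x; y; z] \in K i]].
have sub : [set: 'I_n] \subset
    B :|: ((\bigcup_(i in [set: 'I_k]) W i) :|: [set x; y]).
  apply/subsetP=> z _; rewrite in_setU [X in _ || X]in_setU.
  have [zxy|] := boolP (z \in [set x; y]); first by rewrite !orbT.
  rewrite !inE negb_or orbF ![z == _]eq_sym /bad_triple xy => /andP[xz yz].
  have [-> //|[i iE]] := cover (cards3 xy xz yz).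
  by apply/orP; right; apply/bigcupP; exists i; rewrite ?inE // xz yz.
have := subset_leq_card sub; rewrite cardsT card_ord => /leq_trans; apply.
have [h _] := leq_card_setU B ((\bigcup_(i in [set: 'I_k]) W i) :|: [set x; y]).
apply: leq_trans h _; rewrite leq_add2l.
have [h _] := leq_card_setU (\bigcup_(i in [set: 'I_k]) W i) [set x; y].
apply: leq_trans h _; rewrite cards2 xy leq_add2r.
apply: leq_trans (leq_card_bigcup _ _) _.
rewrite -[X in _ <= X]card_ord -cardsT -sum1_card; apply: leq_sum => i _.
apply/card_le1_eqP => z z'; rewrite !inE => /and3P[xz yz zE] /and3P[xz' yz' zE'].
apply: (nonadjacent_edge_inj (@K3 i) (@Kfree i) (@Kdeg i) _ _ zE' zE) => //.
  by move/existsPn/(_ i): nxy.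
by move/existsPn/(_ i): nyx.
Qed.

End Coloring.

(** * Choice of constants and conclusion *)

Local Open Scope ring_scope.

(** The fraction 113/320 = 0.353125 lies just above 0.353, while 1 / (1 - 113/320) = 320/207 is
    still below 1.546; [eta] is half the first difference. *)
Lemma exists_sample_parameters : exists (c rho eta : rat) (m : nat),
  [/\ 0 <= c, 0 < eta, eta <= 1, c + eta + eta <= rho & 2 < eta ^+ 3 * m%:R] /\
  (forall a b : nat, (1000 * a < 353 * b)%N -> (a%:R : rat) < c * b%:R) /\
  (forall a b : nat, (113 * a <= 320 * b)%N -> rho * a%:R <= b%:R :> rat).
Proof.
have [eta [eta0 eta1 etaE]] : exists eta : rat,
    [/\ 0 < eta, eta <= 1 & 353 / 1000 + eta + eta = 113 / 320].
  by exists ((113 / 320 - 353 / 1000) / 2); split; lra.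
exists (353 / 1000), (113 / 320), eta, (Num.truncn (2 / eta ^+ 3)).+1.
have e3 : 0 < eta ^+ 3 by rewrite exprn_gt0.
split; first split.
- lra.
- by [].
- by [].
- by rewrite etaE lexx.
- have := truncnS_gt (2 / eta ^+ 3).
  by rewrite (ltr_pdivrMr _ _ e3) [X in _ < X -> _]mulrC.
split=> a b; rewrite -?(ltr_nat rat) -?(ler_nat rat) !natrM;
  move: (a%:R : rat) (b%:R : rat) => u v; lra.
Qed.

Local Open Scope nat_scope.

(** Since k + 2 <= 3n/4, D n <= 4b. The cube of n is then at most 10 m^3 b, which is only quadratic
    in n. *)
Lemma short_cycle_arith n m k D D' T T' b :
  n ^ 3 <= 2 * (m ^ 2 * (D' * n) + m ^ 3 * T') ->
  D' <= D -> T' <= T -> D * n <= b + D * (k + 2) -> T <= b ->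
  b <= 2700 * (n * n) -> 4 * (k + 2) <= 3 * n ->
  n <= 5 * (2700 * (2 * m ^ 3)).
Proof.
move=> h DD TT hD Tb hb kn.
have {}hD : D * n <= 4 * b by have := leq_mul (leqnn D) kn; lia.
have m23 : m ^ 2 <= m ^ 3 by case: (m) => // m'; rewrite leq_pexp2l.
have [->//|n0] := posnP n.
rewrite -(leq_pmul2r (m := n * n)) ?muln_gt0 ?n0 //.
have -> : n * (n * n) = n ^ 3 by rewrite !expnS expn0 muln1.
apply: leq_trans h _.
have h1 : m ^ 2 * (D' * n) <= m ^ 3 * (4 * b).
  by apply: leq_mul => //; apply: leq_trans hD; rewrite leq_mul2r DD orbT.
have h2 : m ^ 3 * T' <= m ^ 3 * b by rewrite leq_mul2l (leq_trans TT Tb) orbT.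
have h3 : m ^ 3 * b <= m ^ 3 * (2700 * (n * n)) by rewrite leq_mul2l hb orbT.
lia.
Qed.

Lemma ramsey_property_large : exists N : nat, forall n k : nat,
  N < n -> 113 * n <= 320 * (n - k.+1) -> ramsey_property loose_path k n.
Proof.
have [c [rho [eta [m [[c0 eta0 eta1 crho m_big] [small_c big_rho]]]]]] :=
  exists_sample_parameters.
exists (10 + 5 * (2700 * (2 * m ^ 3))) => n k nN nk chi.
apply: NNPP => no_copy.
have ccH i E : E \in color_class chi i -> #|E| = 3.
  by case/imsetP=> t _ ->; exact/eqP/(valP t).
have /fin_all_exists[K Kcore] : forall i : 'I_k, exists K : hypergraph 'I_n,
    [/\ K \subset color_class chi i,
      forall v, edges_at K v != set0 -> 100 <= #|edges_at K v|
      & #|color_class chi i :\: K| <= 100 * #|'I_n|].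
  by move=> i; exact: exists_core.
pose L := \bigcup_(i in [set: 'I_k]) (color_class chi i :\: K i).
have K3 i : uniform3 (K i).
  by move=> E EK; apply: (ccH i); have [/subsetP-> //] := Kcore i.
have L3 : uniform3 L.
  by move=> E /bigcupP[i _ /setDP[/ccH]].
have Kfree i : ~ contains_copy loose_path (K i).
  case=> f finj fK; apply: no_copy; exists i; exists f => // e /fK.
  by have [/subsetP sub _ _] := Kcore i; exact: sub.
have Kdeg i v : edges_at (K i) v != set0 -> 100 <= #|edges_at (K i) v|.
  by have [_ h _] := Kcore i; exact: h.
have Lcard : #|L| <= k * (100 * n).
  apply: leq_trans (leq_card_bigcup _ _) _.
  rewrite -[X in _ <= X * _]card_ord -[X in _ <= X * _]cardsT -sum_nat_const.
  apply: leq_sum => i _.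
  by have [_ _] := Kcore i; rewrite card_ord.
have cover (E : {set 'I_n}) : #|E| = 3 -> E \in L \/ exists i, E \in K i.
  move=> /eqP E3; pose t : triple 'I_n := exist _ E E3.
  have tE : E \in color_class chi (chi t) by apply/imsetP; exists t; rewrite ?inE.
  have [EK|EK] := boolP (E \in K (chi t)); first by right; exists (chi t).
  by left; apply/bigcupP; exists (chi t); rewrite ?inE ?EK.
pose e := undominated K; pose r := n - k.+1.
(* Sampling is for constant outdegree, so arcs are dropped; short cycles only become fewer. *)
pose e' x y := y \in take r (enum (outs e x)).
have rOut x : r <= #|outs e x|.
  by rewrite leq_subLR addnC; apply: undominated_outdegree.
have e'e x y : e' x y -> e x y.
  by move/mem_take; rewrite mem_enum inE.
have reg x : #|outs e' x| = r.
  by rewrite -[RHS](exists_subset_card (rOut x)); apply: eq_card => y; rewrite !inE.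
have irr x : e' x x = false by apply/negP => /e'e /andP[/eqP].
have dig : digons e' <= digons e.
  apply: leq_sum => x _; apply: leq_sum => y _.
  by case: andP => // -[/e'e -> /e'e ->].
have tri : cyclic_triangles e' <= cyclic_triangles e.
  apply: leq_sum => x _; apply: leq_sum => y _; apply: leq_sum => z _.
  by case: and3P => // -[/e'e -> /e'e -> /e'e ->].
have small_out (d : rel 'I_m) (S : {set 'I_m}) : no_short_cycle d -> 0 < #|S| ->
    exists2 v, v \in S & ((#|outs_in d S v|%:R : rat) < c * #|S|%:R)%R.
  move=> nsc S0; have [v vS vlt] := exists_small_outdegree nsc S0.
  by exists v => //; apply: small_c.
have n0 : 0 < #|'I_n| by rewrite card_ord; lia.
have r_big : (rho * #|'I_n|%:R <= r%:R)%R by apply: big_rho; rewrite card_ord.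
have := many_short_cycles irr reg n0 c0 eta0 eta1 crho r_big small_out m_big.
rewrite card_ord.
have tri_bound := undominated_triangles K3 Kfree Kdeg cover.
have dig_bound := undominated_digons K3 Kfree Kdeg cover.
have bad_bound := sum_bad_triples L3.
have [kn kn4] : k <= n /\ 4 * (k + 2) <= 3 * n by lia.
have b_le : \sum_x \sum_y \sum_z bad_triple L x y z <= 2700 * (n * n).
  apply: leq_trans bad_bound _; have := leq_mul (leqnn 27) Lcard.
  by have := leq_mul kn (leqnn n); lia.
move=> h; suff : n <= 5 * (2700 * (2 * m ^ 3)).
  by rewrite leqNgt (leq_ltn_trans (leq_addl 10 _) nN).
exact: short_cycle_arith h dig tri dig_bound tri_bound b_le kn4.
Qed.

Lemma exists_least (P : nat -> Prop) n : P n ->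
  exists r, [/\ P r, forall s, P s -> r <= s & r <= n].
Proof.
elim/ltn_ind: n => n IHn Pn.
have [[s [sn Ps]]|none] := classic (exists s, s < n /\ P s).
  have [r [Pr rmin rs]] := IHn s sn Ps.
  by exists r; split=> //; apply: leq_trans rs (ltnW sn).
by exists n; split=> // s Ps; rewrite leqNgt; apply/negP => sn; apply: none; exists s.
Qed.

Local Open Scope ring_scope.

Lemma ltr_nat_ratio (a b r k : nat) : (0 < b)%N -> (r * b < a * k)%N ->
  (r%:R : rat) < a%:R / b%:R * k%:R.
Proof.
by move=> b0 lt; rewrite mulrAC ltr_pdivlMr ?ltr0n // -!natrM ltr_nat.
Qed.

Theorem theorem1 :
  exists k0 : nat, forall k : nat, (k0 <= k)%N ->
    exists2 r : nat, is_ramsey_number loose_path k r &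
      (r%:R : rat) < 1.546%Q * k%:R.
Proof.
have [N HN] := ramsey_property_large.
(* As 773 * 207 - 500 * 320 = 11, rounding in [n] is absorbed once 11k > 263500, which k >= 25000
   ensures. *)
exists (N + 5 * 5000)%N => k Nk.
(* This gives 207 n >= 320 (k + 1), which is 113 n <= 320 (n - k - 1). *)
pose n := ((320 * k.+1) %/ 207).+1.
have [n_low n_high] : (320 * k.+1 <= 207 * n /\ 207 * n <= 320 * k.+1 + 207)%N.
  by rewrite /n; lia.
have ram : ramsey_property loose_path k n by apply: HN; lia.
have [r [Pr rmin rn]] := exists_least ram.
exists r; first by split.
have -> : 1.546%Q = 773%:R / 500%:R.
  rewrite -[LHS]divq_num_den.
  have -> : numq 1.546%Q = Posz 773 by reflexivity.
  by have -> : denq 1.546%Q = Posz 500 by reflexivity.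
have lt : (r * 500 < 773 * k)%N by lia.
exact: ltr_nat_ratio.
Qed.
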